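(* There exist an absolute constant $c>0$ and an integer $n_0$ such that the following holds for every $n\ge n_0$: if $\gamma,\Delta\ge 1$ are such that $\textsc{Online-Sorting}[\gamma,n]$ admits a $\Delta$-competitive online algorithm, then \[\gamma\Delta\ \ge\ c\cdot \frac{\log n}{\log\log n}.\] That is, $\gamma\Delta=\Omega(\log n/\log\log n)$.
   Context: $\textsc{Online-Sorting}[\gamma,n]$ (for $\gamma\ge 1$): there is an array $A$ consisting of $\gamma n$ initially empty cells, ordered from left to right. A stream of $n$ reals $s_1,\dots,s_n\in[0,1]$ arrives one at a time (the stream may be chosen adaptively by an adversary depending on the algorithm's previous decisions). An online algorithm must place each $s_i$ into an empty cell of $A$, irrevocably, before $s_{i+1}$ is revealed. After all $n$ reals are placed, let $r_1,\dots,r_n$ be the reals in their left-to-right order in $A$, and set $r_0:=0$, $r_{n+1}:=1$. The cost is $\sum_{i=0}^{n}|r_{i+1}-r_i|$. The offline optimum (placing the reals in sorted order) has cost exactly $1$. An online algorithm is $\Delta$-competitive if its cost is at most $\Delta$ on every stream of $n$ reals in $[0,1]$. *)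

(* Defs.v *)
From Stdlib Require Import Reals.
From mathcomp Require Import ssreflect ssrfun ssrbool eqtype ssrnat seq.

Set Implicit Arguments.
Unset Strict Implicit.

Local Open Scope R_scope.

(* A deterministic online algorithm: given the reals seen so far
   (s_1..s_{i-1}) and the current real s_i, it returns the index of the
   cell (0-based, left to right) in which s_i is placed.  Since the
   algorithm is deterministic, its state is a function of the past
   inputs, so this captures every deterministic online algorithm; an
   adaptive adversary is then no stronger than "every stream". *)
Definition online_alg := seq R -> R -> nat.

Definition num_cells (gamma : R) (n : nat) : nat :=
  Z.to_nat (Int_part (gamma * INR n)).

Definition positions (alg : online_alg) (s : seq R) : seq nat :=
  mkseq (fun i => alg (take i s) (nth 0 s i)) (size s).

Definition valid_run (m : nat) (alg : online_alg) (s : seq R) : Prop :=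
  all (fun p => (p < m)%N) (positions alg s) /\ uniq (positions alg s).

Definition final_order (m : nat) (alg : online_alg) (s : seq R) : seq R :=
  let pos := positions alg s in
  [seq nth 0 s (index j pos) | j <- iota 0 m & j \in pos].

Definition sort_cost (r : seq R) : R :=
  foldr Rplus 0 (pairmap (fun x y => Rabs (y - x)) 0 (rcons r 1)).

Definition competitive (gamma Delta : R) (n : nat) (alg : online_alg) : Prop :=
  forall s : seq R, size s = n ->
    (forall i, (i < size s)%N -> 0 <= nth 0 s i <= 1) ->
    valid_run (num_cells gamma n) alg s /\
    sort_cost (final_order (num_cells gamma n) alg s) <= Delta.

(* Main.v *)
Require Import Defs.
From Stdlib Require Import Reals ZArith Lra Lia.
From mathcomp Require Import ssreflect ssrfun ssrbool eqtype ssrnat seq.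
From mathcomp Require Import fintype bigop zify.

(* Record the array as its gaps: maximal runs of empty cells, each with the
   reals at its two ends.  All reals presented are multiples of 1/Q, where
   Q = b^D, and [0, Q) is split recursively into tiles of width b^d.  Write
   Q Delta for the bound on the final total variation and put
   quota d = eta n b^d / (Q Delta).  The load of a tile is the number of empty
   cells in gaps with both ends in the tile (plus a multiple of the total
   variation inside the tile), and y is its ratio to the quota.

   Every tile of level d can be played so that a score grows at rate at least
   d - 4 y per real, where the score is a sum over the levels below d that stays
   O(eta D n) throughout the game.  For the induction, averaging over the
   children of a tile produces three consecutive ones which, together, no
   long gap leaves and whose load is at most the average one.  If one of them
   has load ratio at most y - 1/4, play it.  Otherwise almost all empty cells
   near the middle child belong to one of the three children, so while the
   middle child is played, either a real lands far from both its neighbours or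
   next to two reals of the same adjacent child, which is charged to level d of
   the score, or one of at most (y + 3/2) quota cells is used up; in the latter
   case the load ratio drops well below y.

   At the root y is O(gamma Delta), so if gamma Delta were much smaller than D,
   the score would grow at rate at least D/2 for n/2 reals, which is impossible
   once eta is a small constant.  Here b is polynomial in D, and D levels fit as
   long as b^D is below about sqrt n, i.e. for D of order log n / log log n. *)

Set Implicit Arguments.
Unset Strict Implicit.

(** * Gaps *)

(* Left end, number of empty cells, right end. *)
Definition gap : Type := (nat * nat * nat)%type.

Definition lval (g : gap) := g.1.1.
Definition room (g : gap) := g.1.2.
Definition rval (g : gap) := g.2.

Definition natdist (a b : nat) := (a - b) + (b - a).

Definition gapsum (f : gap -> nat) (S : seq gap) := \sum_(g <- S) f g.

Inductive insertion (x : nat) : seq gap -> seq gap -> Prop :=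
  Insertion S1 p m1 m2 q S2 :
    insertion x (S1 ++ (p, (m1 + m2).+1, q) :: S2)
                (S1 ++ (p, m1, x) :: (x, m2, q) :: S2).

(** The split is chosen before [f], so that several totals can be compared on the same insertion. *)
Lemma insertion_gapsum x S S' : insertion x S S' ->
  exists p m1 m2 q, forall f : gap -> nat,
    gapsum f S' + f (p, (m1 + m2).+1, q) =
    gapsum f S + f (p, m1, x) + f (x, m2, q).
Proof.
case=> S1 p m1 m2 q S2; exists p, m1, m2, q => f.
by rewrite /gapsum !big_cat !big_cons /=; lia.
Qed.

Definition span (g : gap) := natdist (lval g) (rval g).
Definition span_upto (w : nat) (g : gap) := minn (span g) w.

(** For [a <= e] this is [v] clipped to [a, e] and measured from [a]; the difference of minima makes
    it additive over adjacent intervals. *)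
Definition clamp (a e v : nat) := minn v e - minn v a.
Definition span_in (a e : nat) (g : gap) :=
  natdist (clamp a e (lval g)) (clamp a e (rval g)).

Definition inside (a e v : nat) := (a <= v) && (v < e).
Definition room_in (a e : nat) (g : gap) :=
  if inside a e (lval g) && inside a e (rval g) then room g else 0.

Lemma span_insert p m1 m2 q m x :
  span (p, m, q) <= span (p, m1, x) + span (x, m2, q).
Proof. by rewrite /span /natdist /lval /rval /=; lia. Qed.

Lemma clamp_mono a e u v : u <= v -> clamp a e u <= clamp a e v.
Proof. by rewrite /clamp; lia. Qed.

Lemma clamp_lipschitz a e u v : u <= v ->
  clamp a e v + u <= clamp a e u + v.
Proof. by rewrite /clamp; lia. Qed.

(** [clamp a e] and the identity minus it are both nondecreasing, so [span] is [span_in] plus a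
    variation outside the interval, which obeys the triangle inequality too. *)
Lemma span_in_insert a e p m1 m2 q m x :
  span_in a e (p, m1, x) + span_in a e (x, m2, q) + span (p, m, q) <=
  span_in a e (p, m, q) + span (p, m1, x) + span (x, m2, q).
Proof.
have M := @clamp_mono a e; have L := @clamp_lipschitz a e.
rewrite /span_in /span /natdist /lval /rval /=.
case: (leqP p x) (leqP x q) (leqP p q) => [px|/ltnW xp] [xq|/ltnW qx] [pq|/ltnW qp];
  move: (M _ _ px) (L _ _ px) || move: (M _ _ xp) (L _ _ xp);
  move: (M _ _ xq) (L _ _ xq) || move: (M _ _ qx) (L _ _ qx);
  move: (M _ _ pq) (L _ _ pq) || move: (M _ _ qp) (L _ _ qp);
  move: (clamp a e p) (clamp a e q) (clamp a e x); lia.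
Qed.

Lemma clamp_cat a c e v : a <= c -> c <= e ->
  clamp a e v = clamp a c v + clamp c e v.
Proof. by rewrite /clamp; lia. Qed.

Lemma span_in_cat a c e g : a <= c -> c <= e ->
  span_in a e g = span_in a c g + span_in c e g.
Proof.
move=> ac ce; have M1 := @clamp_mono a c; have M2 := @clamp_mono c e.
rewrite /span_in /natdist !(clamp_cat _ ac ce).
case: (leqP (lval g) (rval g)) => [pq|/ltnW pq];
  move: (M1 _ _ pq) (M2 _ _ pq);
  move: (clamp _ _ _) (clamp _ _ _) (clamp _ _ _) (clamp _ _ _); lia.
Qed.

Section TotalsUnderInsertion.

Context (x : nat) (S S' : seq gap) (step : insertion x S S').

Lemma gapsum_span_mono : gapsum span S <= gapsum span S'.
Proof.
have [p [m1 [m2 [q /(_ span)]]]] := insertion_gapsum step.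
by have := span_insert p m1 m2 q (m1 + m2).+1 x; lia.
Qed.

Lemma gapsum_span_upto_mono w :
  gapsum (span_upto w) S <= gapsum (span_upto w) S'.
Proof.
have [p [m1 [m2 [q /(_ (span_upto w))]]]] := insertion_gapsum step.
by have := span_insert p m1 m2 q (m1 + m2).+1 x; rewrite /span_upto; lia.
Qed.

Lemma gapsum_span_in_le a e :
  gapsum (span_in a e) S' + gapsum span S <= gapsum (span_in a e) S + gapsum span S'.
Proof.
have [p [m1 [m2 [q E]]]] := insertion_gapsum step.
have := E (span_in a e); have := E span.
by have := span_in_insert a e p m1 m2 q (m1 + m2).+1 x; lia.
Qed.

Lemma gapsum_room_lt : (gapsum room S').+1 = gapsum room S.
Proof.
have [p [m1 [m2 [q /(_ room)]]]] := insertion_gapsum step.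
by rewrite /room /=; lia.
Qed.

End TotalsUnderInsertion.

(* Empty cells that a real in the tile [a, a + w) may take without being far
   from both neighbours or between two reals of the same adjacent tile. *)
Definition reach (a w : nat) (g : gap) :=
  let W := inside (a - w) (a + 2 * w) in
  let L := inside (a - w) a in
  let R := inside (a + w) (a + 2 * w) in
  let p := lval g in let q := rval g in
  if [&& W p || W q, ~~ (L p && L q) & ~~ (R p && R q)] then room g else 0.

(** If neither end of the split gap is in the three tiles, [x] is at distance at least [w] from
    both, and the truncated variation grows by [w]. If both ends are in one side tile, [x] is a
    detour of at least [r] each way. Otherwise the gap counts for [reach], as do both new ones, and
    one cell is lost. *)
Lemma insertion_trichotomy x S S' a w r : insertion x S S' ->
  w <= a -> 0 < r -> a + r <= x.+1 -> x + r <= a + w ->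
  [\/ gapsum (span_upto w) S + w <= gapsum (span_upto w) S',
      gapsum span S + 2 * r <= gapsum span S' |
      gapsum (reach a w) S' + 1 <= gapsum (reach a w) S].
Proof.
move=> step le_wa r_gt0 ax xa.
have [p [m1 [m2 [q E]]]] := insertion_gapsum step.
have Lx : inside (a - w) a x = false by rewrite /inside; lia.
have Rx : inside (a + w) (a + 2 * w) x = false by rewrite /inside; lia.
have Wx : inside (a - w) (a + 2 * w) x = true by rewrite /inside; lia.
have := E (reach a w).
rewrite {2 4 5}/reach /lval /rval /room /= Lx Rx Wx ?(andbF, andFb, orbT, orTb) /=.
case: ifPn => [_|]; first by move=> ?; apply: Or33; lia.
rewrite !negb_and !negb_or !negbK => /or3P[Wpq|/andP[Lp Lq]|/andP[Rp Rq]] _.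
- apply: Or31; have := E (span_upto w).
  rewrite {2 4 5}/span_upto /span /natdist /lval /rval /=.
  by move: Wpq; rewrite /inside; lia.
- apply: Or32; have := E span; rewrite {2 4 5}/span /natdist /lval /rval /=.
  by move: Lp Lq; rewrite /inside; lia.
apply: Or32; have := E span; rewrite {2 4 5}/span /natdist /lval /rval /=.
by move: Rp Rq; rewrite /inside; lia.
Qed.

Definition ends_in (a e : nat) (g : gap) :=
  (if inside a e (lval g) then room g else 0) +
  (if inside a e (rval g) then room g else 0).

(** The right side counts a gap once per end in the window. A gap inside a side tile is not in
    [reach], one inside the middle tile is, and all others occur on the left only through [reach];
    hence the weights 2, 1, 2. *)
Lemma reach_ends a w g : w <= a ->
  reach a w g + 2 * room_in (a - w) a g + room_in a (a + w) g +
    2 * room_in (a + w) (a + 2 * w) g <= ends_in (a - w) (a + 2 * w) g.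
Proof.
move=> le_wa; rewrite /reach /room_in /ends_in.
move: (lval g) (rval g) (room g) => p q m.
have W v : inside (a - w) (a + 2 * w) v =
    [|| inside (a - w) a v, inside a (a + w) v | inside (a + w) (a + 2 * w) v].
  by rewrite /inside; lia.
have D1 v : inside (a - w) a v -> inside a (a + w) v = false.
  by rewrite /inside; lia.
have D2 v : inside (a + w) (a + 2 * w) v -> inside a (a + w) v = false.
  by rewrite /inside; lia.
have D3 v : inside (a - w) a v -> inside (a + w) (a + 2 * w) v = false.
  by rewrite /inside; lia.
rewrite !W; move: (D1 p) (D1 q) (D2 p) (D2 q) (D3 p) (D3 q).
case: (inside (a - w) a p); case: (inside (a - w) a q);
case: (inside a (a + w) p); case: (inside a (a + w) q);
case: (inside (a + w) _ p); case: (inside (a + w) _ q);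
  move=> /= d1 d2 d3 d4 d5 d6; lia.
Qed.

Lemma room_in_reach a w g : w <= a -> room_in a (a + w) g <= reach a w g.
Proof.
move=> le_wa; rewrite /room_in /reach; case: ifP => // /andP[p q].
suff -> : [&& inside (a - w) (a + 2 * w) (lval g)
          || inside (a - w) (a + 2 * w) (rval g),
          ~~ (inside (a - w) a (lval g) && inside (a - w) a (rval g))
        & ~~ (inside (a + w) (a + 2 * w) (lval g)
          && inside (a + w) (a + 2 * w) (rval g))] by [].
by move: p q; rewrite /inside; lia.
Qed.

(** * Cheap windows *)

Lemma sum_inside_tiles a w v m n : m <= n ->
  \sum_(m <= k < n) (if inside (a + k * w) (a + k * w + w) v then 1 else 0) =
  (if inside (a + m * w) (a + n * w) v then 1 else 0).
Proof.
move=> /subnKC <-; elim: (n - m) => [|d IH].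
  by rewrite addn0 big_geq // /inside; case: ifP => //; lia.
rewrite addnS big_nat_recr ?leq_addr //= IH mulSn.
have : m * w <= (m + d) * w by rewrite leq_mul2r leq_addr orbT.
by rewrite /inside; repeat case: ifP; lia.
Qed.

Lemma sum_span_in_tiles a w g m n : m <= n ->
  \sum_(m <= k < n) span_in (a + k * w) (a + k * w + w) g =
  span_in (a + m * w) (a + n * w) g.
Proof.
move=> /subnKC <-; elim: (n - m) => [|d IH].
  by rewrite addn0 big_geq // /span_in /clamp !subnn.
have le_md : m * w <= (m + d) * w by rewrite leq_mul2r leq_addr orbT.
rewrite addnS big_nat_recr ?leq_addr //= IH mulSn.
rewrite [in RHS](@span_in_cat _ (a + (m + d) * w)); [|lia|lia].
by congr (_ + span_in _ _ _); lia.
Qed.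

Lemma span_in_sub a a' e e' g : a <= a' -> a' <= e' -> e' <= e ->
  span_in a' e' g <= span_in a e g.
Proof.
move=> aa ae ee; rewrite (@span_in_cat a a' e) ?(leq_trans ae) //.
by rewrite (@span_in_cat a' e' e) //; lia.
Qed.

Definition end_cost a e W1 W2 Z (p m q : nat) :=
  if inside W1 W2 p then (if inside a e q then m else Z) else 0.

(* [Z] is a penalty for gaps that leave [a, e); it exceeds the average cost, so
   that a window of at most average cost meets no such gap. *)
Definition window_cost a e W1 W2 Z beta (g : gap) :=
  end_cost a e W1 W2 Z (lval g) (room g) (rval g) +
  end_cost a e W1 W2 Z (rval g) (room g) (lval g) +
  2 * beta * span_in W1 W2 g.

(** A point lies in at most three of the windows, one for each position of its tile in the
    window. *)
Lemma sum_end_cost a b s w Z p m q : 2 * s + 2 <= b ->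
  \sum_(s <= k < b - s - 2)
    end_cost a (a + b * w) (a + k * w) (a + k * w + 3 * w) Z p m q <=
  3 * end_cost a (a + b * w) (a + s * w) (a + (b - s) * w) Z p m q.
Proof.
move=> le_sb; rewrite /end_cost; move: (if inside a _ q then _ else _) => c.
have le3 k : (if inside (a + k * w) (a + k * w + 3 * w) p then c else 0) <=
    c * ((if inside (a + k * w) (a + k * w + w) p then 1 else 0) +
    (if inside (a + w + k * w) (a + w + k * w + w) p then 1 else 0) +
    (if inside (a + 2 * w + k * w) (a + 2 * w + k * w + w) p then 1 else 0)).
  rewrite /inside; case: ifP => //.
  by repeat case: ifP; lia.
apply: leq_trans (leq_sum _ _) _ => [k _|]; first exact: le3.
rewrite -big_distrr /= !big_split /= !sum_inside_tiles; try lia.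
suff sub o o' : s * w <= o -> o' <= (b - s) * w ->
    (if inside (a + o) (a + o') p then 1 else 0) <=
    (if inside (a + s * w) (a + (b - s) * w) p then 1 else 0).
  have E : (b - s) * w = (b - s - 2) * w + 2 * w.
    by rewrite -mulnDl; congr (_ * _); lia.
  have le_s : s * w <= (b - s) * w by apply: leq_mul; lia.
  move: ((b - s) * w) ((b - s - 2) * w) E le_s sub => y z E le_s sub.
  have le0 : z <= y by lia.
  have le1 : w + z <= y by lia.
  have le2 : 2 * w + z <= y by lia.
  have := sub _ _ (leqnn _) le0; have := sub _ _ (leq_addl w _) le1.
  have := sub _ _ (leq_addl (2 * w) _) le2; rewrite !addnA.
  by case: (inside (a + s * w) (a + y) p); nia.
by rewrite /inside; repeat case: ifP; lia.
Qed.

(** A gap paying the penalty [Z] has one end outside [a, e) and the other at least [s] tiles from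
    the border, so its variation inside is at least [s * w] and pays for the penalty. The factor 6
    is three windows times two ends. *)
Lemma sum_window_cost a b s w Z beta g : 2 * s + 2 <= b ->
  s * w * \sum_(s <= k < b - s - 2)
    window_cost a (a + b * w) (a + k * w) (a + k * w + 3 * w) Z beta g <=
  6 * (s * w) * (room_in a (a + b * w) g + beta * span_in a (a + b * w) g) +
  3 * Z * span_in a (a + b * w) g.
Proof.
move=> le_sb; set e := a + b * w.
have C1 := @sum_end_cost a b s w Z (lval g) (room g) (rval g) le_sb.
have C2 := @sum_end_cost a b s w Z (rval g) (room g) (lval g) le_sb.
have Ebw : (b - s) * w + s * w = b * w.
  by rewrite -mulnDl; congr (_ * _); lia.
have E2 : (b - s - 2) * w + 2 * w + s * w = b * w.
  by rewrite -!mulnDl; congr (_ * _); lia.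
have C3 : \sum_(s <= k < b - s - 2) span_in (a + k * w) (a + k * w + 3 * w) g
    <= 3 * span_in a e g.
  have spl k : span_in (a + k * w) (a + k * w + 3 * w) g =
      span_in (a + k * w) (a + k * w + w) g +
      span_in (a + w + k * w) (a + w + k * w + w) g +
      span_in (a + 2 * w + k * w) (a + 2 * w + k * w + w) g.
    rewrite (@span_in_cat _ (a + k * w + w)); [|lia|lia].
    rewrite (@span_in_cat (a + k * w + w) (a + k * w + 2 * w)); [|lia|lia].
    by rewrite addnA; congr (span_in _ _ _ + span_in _ _ _ + span_in _ _ _); lia.
  rewrite (eq_bigr _ (fun k _ => spl k)) 2!big_split /=.
  rewrite !sum_span_in_tiles; try lia.
  have le_sw : s * w <= (b - s - 2) * w by apply: leq_mul; lia.
  have sub o : o <= 2 * w ->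
      span_in (a + o + s * w) (a + o + (b - s - 2) * w) g <= span_in a e g.
    by move=> le_o; apply: span_in_sub; rewrite /e; lia.
  have := sub 0; have := sub w; have := sub (2 * w); rewrite addn0; lia.
have key : s * w * (end_cost a e (a + s * w) (a + (b - s) * w) Z (lval g) (room g) (rval g) +
   end_cost a e (a + s * w) (a + (b - s) * w) Z (rval g) (room g) (lval g)) <=
   2 * (s * w) * room_in a e g + Z * span_in a e g.
  rewrite /end_cost /room_in /span_in.
  have dl u v : inside (a + s * w) (a + (b - s) * w) u -> ~~ inside a e v ->
      s * w <= natdist (clamp a e u) (clamp a e v) /\
      s * w <= natdist (clamp a e v) (clamp a e u).
    by rewrite /inside /e /natdist /clamp; lia.
  have := dl (lval g) (rval g); have := dl (rval g) (lval g).
  have sub v : inside (a + s * w) (a + (b - s) * w) v -> inside a e v.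
    by rewrite /inside /e; lia.
  have := sub (lval g); have := sub (rval g).
  move: (inside _ (a + _) (lval g)) (inside _ (a + _) (rval g)).
  move: (inside a e (lval g)) (inside a e (rval g)).
  move: (natdist (clamp a e (lval g)) _) (natdist (clamp a e (rval g)) _).
  move: (s * w) (room g) => k m d d'.
  move=> [] [] [] [] //= h1 h2 h3 h4; try (have := h1 isT); try (have := h2 isT) => //;
  try (have := h3 isT isT); try (have := h4 isT isT) => //; nia.
rewrite /window_cost !big_split /= -big_distrr /=.
apply: leq_trans (leq_mul (leqnn _)
  (leq_add (leq_add C1 C2) (leq_mul (leqnn (2 * beta)) C3))) _.
move: key; rewrite -/e.
move: (end_cost _ _ _ _ _ (lval g) _ _) (end_cost _ _ _ _ _ (rval g) _ _).
by move: (span_in _ _ _) (room_in _ _ _) (s * w) => v r k y1 y2; nia.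
Qed.

(** Some window costs at most the average over all [b - 2 * s - 2] of them; the bound is kept free
    of divisions. *)
Lemma cheap_window S a b s w Z beta : 2 * s + 2 < b ->
  exists2 k, s <= k < b - s - 2 &
  (b - 2 * s - 2) * (s * w *
     gapsum (window_cost a (a + b * w) (a + k * w) (a + k * w + 3 * w) Z beta) S)
  <= 6 * (s * w) * (gapsum (room_in a (a + b * w)) S +
                    beta * gapsum (span_in a (a + b * w)) S) +
     3 * Z * gapsum (span_in a (a + b * w)) S.
Proof.
move=> lt_sb; pose f k := gapsum
  (window_cost a (a + b * w) (a + k * w) (a + k * w + 3 * w) Z beta) S.
pose U := 6 * (s * w) * (gapsum (room_in a (a + b * w)) S +
  beta * gapsum (span_in a (a + b * w)) S) +
  3 * Z * gapsum (span_in a (a + b * w)) S.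
have sumU : s * w * \sum_(s <= k < b - s - 2) f k <= U.
  rewrite /f /gapsum exchange_big /= /U /gapsum !big_distrr -big_split /=.
  rewrite big_distrr -big_split /=; apply: leq_sum => g _.
  by apply: sum_window_cost; lia.
have [H|/allPn[k]] := boolP (all (fun k => U < (b - 2 * s - 2) * (s * w * f k))
    (index_iota s (b - s - 2))); last first.
  by rewrite mem_index_iota -leqNgt => ? ?; exists k.
have : \sum_(s <= k < b - s - 2) U.+1 <=
    \sum_(s <= k < b - s - 2) (b - 2 * s - 2) * (s * w * f k).
  rewrite [leqLHS]big_seq [leqRHS]big_seq.
  by apply: leq_sum => k; exact: (allP H).
rewrite sum_nat_const_nat -!big_distrr /=.
have -> : b - s - 2 - s = b - 2 * s - 2 by lia.
by rewrite leq_mul2l; lia.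
Qed.

(** * The adversary *)

Lemma natrD m n : INR (m + n) = (INR m + INR n)%R.
Proof. exact: plus_INR. Qed.
Lemma natrM m n : INR (m * n) = (INR m * INR n)%R.
Proof. exact: mult_INR. Qed.
Lemma natr_le m n : m <= n -> (INR m <= INR n)%R.
Proof. by move=> le_mn; apply: le_INR; lia. Qed.
Lemma natr_lt m n : m < n -> (INR m < INR n)%R.
Proof. by move=> lt_mn; apply: lt_INR; lia. Qed.

Lemma leq_gapsum (f g : gap -> nat) S :
  (forall x, f x <= g x) -> gapsum f S <= gapsum g S.
Proof. by move=> le_fg; apply: leq_sum. Qed.

Lemma gapsumD (f g : gap -> nat) S :
  gapsum (fun x => f x + g x) S = gapsum f S + gapsum g S.
Proof. by rewrite /gapsum big_split. Qed.

Lemma gapsumM c (f : gap -> nat) S :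
  gapsum (fun x => c * f x) S = c * gapsum f S.
Proof. by rewrite /gapsum big_distrr. Qed.

Lemma mem_gapsum (f : gap -> nat) S g : g \in S -> f g <= gapsum f S.
Proof. by move=> gS; rewrite /gapsum (big_rem g) //= leq_addr. Qed.

Lemma span_in_le a e g : span_in a e g <= span g.
Proof.
have M := @clamp_mono a e; have L := @clamp_lipschitz a e.
rewrite /span_in /span /natdist.
case: (leqP (lval g) (rval g)) => [pq|/ltnW pq]; move: (M _ _ pq) (L _ _ pq);
  move: (clamp _ _ _) (clamp _ _ _); lia.
Qed.

Lemma window_cost_ends a e W1 W2 Z beta S :
  gapsum (window_cost a e W1 W2 Z beta) S < Z ->
  gapsum (ends_in W1 W2) S + 2 * beta * gapsum (span_in W1 W2) S <=
  gapsum (window_cost a e W1 W2 Z beta) S.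
Proof.
move=> ltZ; rewrite -gapsumM -gapsumD /gapsum big_seq [leqRHS]big_seq.
apply: leq_sum => g gS.
have := leq_ltn_trans (mem_gapsum (window_cost a e W1 W2 Z beta) gS) ltZ.
rewrite /window_cost /ends_in /end_cost.
by repeat case: ifP => _; lia.
Qed.

(** Here [N] is the quota of a child, [w] its width, [F] and [V] the load and variation of the
    parent, [X] the cost of the cheap window. The average is about [6 * N * y]; the slack [N / 4]
    absorbs the omitted border tiles and the penalty. *)
Lemma window_arith (D N w F V X s b y : R) :
  (1 <= D)%R -> (1 <= N)%R -> (1 <= w)%R ->
  (s = 200 * D * D)%R -> (b = 200 * D * s)%R ->
  (0 <= y)%R -> (4 * y <= D)%R ->
  (F = y * (b * N))%R -> (V <= y * (b * w))%R ->
  ((b - 2 * s - 2) * (s * w * X) <= 6 * (s * w) * F + 3 * (6 * N * (D + 1)) * V)%R ->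
  (X <= 6 * N * (y + 1 / 24))%R.
Proof.
move=> D1 N1 w1 Es Eb y0 yD EF leV H.
have DD : (1 <= D * D)%R by nra.
have s1 : (200 <= s)%R by nra.
have b1 : (200 * s <= b)%R by nra.
have H1 : ((b - 2 * s - 2) * s * X <= 6 * N * (y * b * (s + 3 * (D + 1))))%R.
  apply: (Rmult_le_reg_l w); first lra.
  have : (3 * (6 * N * (D + 1)) * V <= 3 * (6 * N * (D + 1)) * (y * (b * w)))%R.
    by apply: Rmult_le_compat_l => //; nra.
  by rewrite EF in H; lra.
apply: Rnot_lt_le => ltX.
have c0 : (0 < (b - 2 * s - 2) * s)%R by nra.
have : ((b - 2 * s - 2) * s * (6 * N * (y + 1 / 24)) <
    6 * N * (y * b * (s + 3 * (D + 1))))%R.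
  apply: Rlt_le_trans H1; exact: Rmult_lt_compat_l.
have -> : ((b - 2 * s - 2) * s * (6 * N * (y + 1 / 24)) =
    6 * N * ((b - 2 * s - 2) * s * (y + 1 / 24)))%R by ring.
move=> /Rmult_lt_reg_l H2; have {}H2 := H2 ltac:(lra).
(* The terms [y * b * s] cancel in [H2]. The two remaining errors are at most [s * b / 200] and
   [s * b / 100], less together than the [s * b / 48] left on the other side. *)
have e1 : (y * ((2 * s + 2) * s) <= D / 4 * (3 * s * s))%R.
  apply: Rmult_le_compat; [lra|nra|lra|nra].
have e2 : (y * (3 * (D + 1) * b) <= D / 4 * (6 * D * b))%R.
  apply: Rmult_le_compat; [lra|nra|lra|nra].
have e3 : (D / 4 * (3 * s * s) <= s * b / 200)%R by rewrite Eb; nra.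
have e4 : (D / 4 * (6 * D * b) <= s * b / 100)%R by rewrite Es; nra.
have e5 : (b / 2 <= b - 2 * s - 2)%R by lra.
have e6 : (b / 2 * s / 24 <= (b - 2 * s - 2) * s / 24)%R by nra.
have e7 : (0 < b * s)%R by nra.
nra.
Qed.

Lemma natr_cost r s w X F V q D :
  r * (s * w * X) <= 6 * (s * w) * F + 3 * (6 * q * D.+1) * V ->
  (INR r * (INR s * INR w * INR X) <=
   6 * (INR s * INR w) * INR F + 3 * (6 * INR q * (INR D + 1)) * INR V)%R.
Proof.
move=> /natr_le; rewrite natrD !natrM -S_INR.
have -> : INR 6 = 6%R by rewrite INR_IZR_INZ.
by have -> : INR 3 = 3%R by rewrite INR_IZR_INZ.
Qed.

(** * Histories of a play *)

Section Monotonicity.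

(** [G] gives the gaps after each history of presented values; cutting values to [Q] makes every
    history legal. *)
Context (n Q : nat) (G : seq nat -> seq gap).
Context (GS : forall h x, size h < n ->
  insertion (minn x Q) (G h) (G (rcons h x))).

Lemma gapsum_span_cat h t : size (h ++ t) <= n ->
  gapsum span (G h) <= gapsum span (G (h ++ t)).
Proof.
elim/last_ind: t => [|t x IH]; rewrite ?cats0 // -rcons_cat size_rcons => lt_n.
exact: leq_trans (IH (ltnW lt_n)) (gapsum_span_mono (GS _ lt_n)).
Qed.

Lemma gapsum_span_upto_cat w h t : size (h ++ t) <= n ->
  gapsum (span_upto w) (G h) <= gapsum (span_upto w) (G (h ++ t)).
Proof.
elim/last_ind: t => [|t x IH]; rewrite ?cats0 // -rcons_cat size_rcons => lt_n.
exact: leq_trans (IH (ltnW lt_n)) (gapsum_span_upto_mono (GS _ lt_n) w).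
Qed.

End Monotonicity.

Section Game.

Context (D : nat).
Context (D_gt0 : 0 < D).

(** [margin] children are left out at each border of a tile, and [ratio] bounds [width d] over
    [depth d]. Their growth in [D] keeps the errors in [window_arith] below its slack. *)
Definition margin := 200 * D * D.
Definition ratio := 200 * D.
Definition branch := ratio * margin.
Definition width (d : nat) := branch ^ d.
(* Reals presented in a tile of level [d] are at distance at least [depth d] from
   the other tiles of that level. *)
Definition depth (d : nat) := if d is d'.+1 then margin * width d' else 1.

Lemma branch_gt1 : 1 < branch.
Proof. by rewrite /branch /ratio /margin; nia. Qed.

Lemma width_gt0 d : 0 < width d.
Proof. by rewrite /width expn_gt0 ltnW // branch_gt1. Qed.

Lemma depth_gt0 d : 0 < depth d.
Proof.
case: d => //= d; rewrite muln_gt0 width_gt0 andbT /margin; nia.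
Qed.

Lemma widthS d : width d.+1 = branch * width d.
Proof. exact: expnS. Qed.

Lemma width_depth d : width d <= ratio * depth d.
Proof.
case: d => [|d]; last by rewrite widthS /depth /branch mulnA.
by rewrite /= /ratio /width; nia.
Qed.

Context (beta n M B : nat).
Context (beta_gt0 : 0 < beta).

Let Q := width D.

Context (G : seq nat -> seq gap).
Context (G0 : G [::] = [:: (0, M, Q)]).
Context (GS : forall h x, size h < n ->
  insertion (minn x Q) (G h) (G (rcons h x))).
Context (GB : forall h, size h <= n -> gapsum span (G h) <= B).

Definition jump d S S' :=
  if gapsum span S + 2 * depth d <= gapsum span S' then width d else 0.

Definition jumps d h := \sum_(i < size h) jump d (G (take i h)) (G (take i.+1 h)).

Lemma jumps_rcons d h x : jumps d (rcons h x) = jumps d h + jump d (G h) (G (rcons h x)).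
Proof.
rewrite /jumps size_rcons big_ord_recr /=; congr (_ + jump _ (G _) (G _)).
- apply: eq_bigr => i _; rewrite -cats1 !takel_cat //; exact: ltnW.
- by rewrite -cats1 takel_cat // take_size.
- by rewrite take_oversize // size_rcons.
Qed.

(* The three terms are bounded by the total variation, the last one after
   summation over [d] (up to the factor [ratio]): a jump of size [tau] is only
   counted at the levels of width at most [ratio * tau / 2]. *)
Definition gain d h :=
  gapsum (span_upto (width d)) (G h) + 2 * gapsum span (G h) + jumps d h.

Definition score d h := \sum_(i < d) gain i h.

Lemma jumps_cat d h t : jumps d h <= jumps d (h ++ t).
Proof.
elim/last_ind: t => [|t x IH]; rewrite ?cats0 // -rcons_cat jumps_rcons.
exact: leq_trans IH (leq_addr _ _).
Qed.

Lemma gain_cat d h t : size (h ++ t) <= n -> gain d h <= gain d (h ++ t).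
Proof.
move=> le_n; have := gapsum_span_cat GS le_n; have := jumps_cat d h t.
by have := gapsum_span_upto_cat GS (width d) le_n; rewrite /gain; lia.
Qed.

Lemma score_cat d h t : size (h ++ t) <= n -> score d h <= score d (h ++ t).
Proof. by move=> le_n; apply: leq_sum => i _; apply: gain_cat. Qed.

Lemma scoreS d h : score d.+1 h = score d h + gain d h.
Proof. by rewrite /score big_ord_recr. Qed.

(** The bounds are those of [insertion_trichotomy]; at level 0, where width and depth are 1, they
    leave only [x = k]. *)
Definition deep d k :=
  all (fun x => (k * width d + depth d <= x.+1) &&
                (x + depth d <= k * width d + width d)).

(** Either of the first two alternatives of [insertion_trichotomy] would raise the gain by
    [width d], so every real of [t] falls under the third and uses up a cell of [reach]. *)
Lemma reach_cat d k h t : size (h ++ t) <= n -> 0 < k ->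
  k * width d + width d <= Q -> deep d k t ->
  gain d (h ++ t) < gain d h + width d ->
  gapsum (reach (k * width d) (width d)) (G (h ++ t)) + size t <=
  gapsum (reach (k * width d) (width d)) (G h).
Proof.
move=> le_n k_gt0 leQ; elim/last_ind: t le_n => [|t x IH]; first by rewrite cats0 addn0.
rewrite -rcons_cat !size_rcons /deep all_rcons => lt_n /andP[/andP[x1 x2] dt] ltg.
have d0 := depth_gt0 d.
have step := GS x lt_n; rewrite (_ : minn x Q = x) in step; last by lia.
have le_w : width d <= k * width d by rewrite leq_pmull.
have := IH (ltnW lt_n) dt.
move: ltg; have := gain_cat d (ltnW lt_n).
have : gain d (h ++ t) <= gain d (rcons (h ++ t) x).
  by rewrite -cats1; apply: gain_cat; rewrite cats1 size_rcons.
have := gapsum_span_mono step; have := gapsum_span_upto_mono step (width d).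
rewrite /gain jumps_rcons; have := jumps_cat d h t.
have := insertion_trichotomy step le_w d0 x1 x2.
rewrite /jump; case: ifP => j0 [H|H|H]; lia.
Qed.

Definition load d k h :=
  gapsum (room_in (k * width d) (k * width d + width d)) (G h) +
  beta * gapsum (span_in (k * width d) (k * width d + width d)) (G h).

(** [beta] is the number of reals allowed per unit of width. *)
Definition quota d := beta * width d.

Lemma quota_gt0 d : 0 < quota d.
Proof. by rewrite muln_gt0 beta_gt0 width_gt0. Qed.

Lemma quotaS d : quota d.+1 = branch * quota d.
Proof. by rewrite /quota widthS; nia. Qed.

(** * Playing a tile *)

Definition rate d k h : R := (INR d - 4 * (INR (load d k h) / INR (quota d)))%R.

Definition progress d h h' : R :=
  (80 * INR beta * (INR (score d h') - INR (score d h)))%R.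

Definition playable d := forall h k, size h + quota d <= n ->
  k * width d + width d <= Q ->
  exists t, [/\ 0 < size t <= quota d, deep d k t &
    (INR (size t) * rate d k h <= progress d h (h ++ t))%R].

(** The total variation enters [gain] with coefficient 2, so it has grown by less than half of
    [width d], and the variation part of the load by at most half a quota. The room part is
    controlled by [reach_cat]. *)
Lemma load_cat d k h t : size (h ++ t) <= n -> 0 < k ->
  k * width d + width d <= Q -> deep d k t ->
  gain d (h ++ t) < gain d h + width d ->
  (2 * INR (load d k (h ++ t)) + 2 * INR (size t) <=
   2 * INR (gapsum (reach (k * width d) (width d)) (G h) +
     beta * gapsum (span_in (k * width d) (k * width d + width d)) (G h)) +
   INR (quota d))%R.
Proof.
move=> le_n k_gt0 leQ dt ltg; have H := reach_cat le_n k_gt0 leQ dt ltg.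
have le_w : width d <= k * width d by rewrite leq_pmull.
have T : gapsum (room_in (k * width d) (k * width d + width d)) (G (h ++ t)) <=
    gapsum (reach (k * width d) (width d)) (G (h ++ t)).
  by apply: leq_gapsum => g; apply: room_in_reach.
have V u : size (h ++ u) <= n ->
    gapsum (span_in (k * width d) (k * width d + width d)) (G (h ++ u)) +
    gapsum span (G h) <=
    gapsum (span_in (k * width d) (k * width d + width d)) (G h) +
    gapsum span (G (h ++ u)).
  elim/last_ind: u => [|u x IH]; first by rewrite cats0 addnC.
  rewrite -rcons_cat size_rcons => lt_n; have := IH (ltnW lt_n).
  have := gapsum_span_in_le (GS x lt_n) (k * width d) (k * width d + width d).
  by lia.
pose r := gapsum (reach (k * width d) (width d)) (G h) +
  beta * gapsum (span_in (k * width d) (k * width d + width d)) (G h).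
suff : load d k (h ++ t) + load d k (h ++ t) + (size t + size t) <=
    r + r + quota d.
  move=> /natr_le; rewrite -/r.
  move: (load _ _ _) r (quota _) (size t) => a b c e.
  by rewrite !natrD; lra.
have := V t le_n; have := gapsum_span_cat GS le_n.
have := gapsum_span_upto_cat GS (width d) le_n; have := jumps_cat d h t.
move: ltg H T; rewrite /gain /load /quota /r.
move: (gapsum (span_in _ _) (G (h ++ t))) (gapsum (span_in _ _) (G h)) => v' v.
move: (gapsum span _) (gapsum span (G h)) => V2 V1 ltg H T J U V12 Vv.
have : beta * (2 * v') <= beta * (2 * v + width d) by rewrite leq_mul2l; lia.
by lia.
Qed.

(** The tile is played again and again until six quotas are presented or the gain of level [d] has
    grown by [width d]; the last piece may overshoot by one quota, whence 7. *)
Lemma play_center d h k (y : R) : playable d -> 0 < k ->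
  size h + 7 * quota d <= n -> k * width d + width d <= Q ->
  (INR (gapsum (reach (k * width d) (width d)) (G h) + beta *
    gapsum (span_in (k * width d) (k * width d + width d)) (G h))
   <= INR (quota d) * (y + 3 / 2))%R ->
  exists t, [/\ 0 < size t <= 7 * quota d, deep d k t &
    (INR (size t) * (INR d.+1 - 4 * y) <= progress d.+1 h (h ++ t))%R].
Proof.
move=> IH k_gt0 le_n leQ le_y; have N_gt0 := quota_gt0 d.
set N := INR (quota d) in le_y *.
have N1 : (1 <= N)%R by apply: (natr_le N_gt0).
(* After T reals the load ratio is at most [y + 2 - T / N], so the rate is at least
   [d - 4 y - 8 + 4 T / N]; summation gives the quadratic term. Having 10 instead of 8 pays for the
   rate being fixed during a piece of at most [N] reals. *)
pose inv t := [/\ size t <= 7 * quota d, deep d k t &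
  (INR (size t) * (INR d - 4 * y - 10) + 2 * (INR (size t) * INR (size t)) / N
    <= progress d h (h ++ t))%R].
pose over t := (6 * quota d <= size t) || (gain d h + width d <= gain d (h ++ t)).
have loop m : exists t, inv t /\ (over t \/ m <= size t).
  elim: m => [|m [t [invt H]]].
    exists [::]; split; last by right.
    by split=> //=; rewrite cats0 /progress /= /Rdiv; lra.
  case: H => [H|le_mt]; first by exists t; split=> //; left.
  have [ov|] := boolP (over t); first by exists t; split=> //; left.
  rewrite /over negb_or -!ltnNge => /andP[lt_t ltg].
  case: invt => le_t dt sc_t.
  have le_ht : size (h ++ t) + quota d <= n by rewrite size_cat; lia.
  have [u [/andP[u0 uN] du sc_u]] := IH _ _ le_ht leQ.
  exists (t ++ u); split; last by right; rewrite size_cat; lia.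
  split; first by rewrite size_cat; lia.
    by rewrite /deep all_cat; apply/andP; split.
  have {}le_ht : size (h ++ t) <= n by lia.
  have := load_cat le_ht k_gt0 leQ dt ltg.
  move: sc_t sc_u le_y (natr_le uN) (pos_INR (size u)).
  rewrite /rate /progress catA size_cat [INR (size t + _)]natrD -/N.
  move: (INR (load _ _ _)) (INR (gapsum _ _ + _)) (INR (size t)) (INR (size u)) => L r T U.
  set a := (_ * (INR _ - INR _))%R; set a' := (_ * (INR _ - INR (score d (h ++ t))))%R.
  have -> : (80 * INR beta * (INR (score d ((h ++ t) ++ u)) - INR (score d h)) = a + a')%R.
    by rewrite /a /a'; ring.
  move: a a' => a a' sc_t sc_u le_y UN U0 LL.
  have L' : (L <= N * (y + 2) - T)%R by lra.
  have q1 : (L / N <= y + 2 - T / N)%R.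
    have -> : (y + 2 - T / N = (N * (y + 2) - T) / N)%R by field; lra.
    by apply: Rmult_le_compat_r => //; left; apply: Rinv_0_lt_compat; lra.
  have q2 : (U * U / N <= U)%R.
    have -> : (U * U / N = U * (U / N))%R by field; lra.
    have : (U / N <= 1)%R by apply: (Rmult_le_reg_r N); [lra|]; field_simplify; lra.
    by move=> ?; rewrite -{3}[U]Rmult_1_r; apply: Rmult_le_compat_l.
  have q3 : (U * (INR d - 4 * (y + 2 - T / N)) <= U * (INR d - 4 * (L / N)))%R.
    by apply: Rmult_le_compat_l => //; lra.
  have -> : (2 * ((T + U) * (T + U)) / N =
    2 * (T * T) / N + 4 * (U * (T / N)) + 2 * (U * U / N))%R by field; lra.
  by nra.
have [t [[le_t dt sc_t] H]] := loop (6 * quota d).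
have ov : over t by case: H => //; rewrite /over => ->.
have szht : size (h ++ t) <= n by rewrite size_cat; lia.
have t_gt0 : 0 < size t.
  case: t {le_t dt sc_t H szht} ov => //=; rewrite /over /= cats0.
  by have := width_gt0 d; lia.
exists t; split=> //; first by rewrite t_gt0.
have := natr_le (gain_cat d szht).
have T7 := natr_le le_t.
have T0 := pos_INR (size t); have b0 := pos_INR beta.
move: sc_t; rewrite /progress !scoreS S_INR.
rewrite [INR (score d (h ++ t) + _)]natrD [INR (score d h + _)]natrD.
rewrite natrM -/N in T7.
have [|gn] := orP ov => [/natr_le|].
  rewrite natrM -/N [INR 6]/= => T6 sc_t g0.
  (* For T at least [6 N] the quadratic term is at least 12 T, and only 11 T is missing. *)
  have : (INR (size t) * 12 <= 2 * (INR (size t) * INR (size t)) / N)%R.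
    have -> : (2 * (INR (size t) * INR (size t)) / N =
      INR (size t) * (2 * INR (size t) / N))%R by field; lra.
    apply: Rmult_le_compat_l => //; apply: (Rmult_le_reg_r N); first lra.
    by field_simplify; lra.
  by nra.
have {}gn := natr_le gn; rewrite natrD in gn => sc_t g0.
(* The missing 11 T is at most [77 N]; the gain of [width d] is worth [80 N], which explains the
   factor 80 in [progress]. *)
have : (80 * N <= 80 * INR beta * (INR (gain d (h ++ t)) - INR (gain d h)))%R.
  by rewrite /N /quota natrM; nra.
have : (0 <= 2 * (INR (size t) * INR (size t)) / N)%R.
  by apply: Rmult_le_pos; [nra|left; apply: Rinv_0_lt_compat; lra].
rewrite [INR 7]/= in T7.
by nra.
Qed.

Lemma playableS_deep d j c : (j * branch + margin <= c)%N ->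
  c + margin < j * branch + branch -> forall t, deep d c t -> deep d.+1 j t.
Proof.
move=> le1 le2 t; apply: sub_all => x /andP[x1 x2].
rewrite widthS /= mulnA.
have := leq_mul le1 (leqnn (width d)); have := leq_mul le2 (leqnn (width d)).
by rewrite mulSn !mulnDl; lia.
Qed.

(** This is [reach_ends] summed over all gaps, with the variation of the window split among its
    three tiles: heavy tiles leave little room for [reach]. *)
Lemma window_loads d c h X : 0 < c ->
  gapsum (ends_in (c * width d - width d) (c * width d + 2 * width d)) (G h) +
  2 * beta *
    gapsum (span_in (c * width d - width d) (c * width d + 2 * width d)) (G h)
  <= X ->
  gapsum (reach (c * width d) (width d)) (G h) +
    beta * gapsum (span_in (c * width d) (c * width d + width d)) (G h) +
    (load d c.-1 h + load d c.-1 h + load d c h + (load d c.+1 h + load d c.+1 h))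
  <= X.
Proof.
move=> c0; apply: leq_trans.
have le_w : width d <= c * width d by rewrite leq_pmull.
have E1 : c.-1 * width d = c * width d - width d by rewrite -subn1 mulnBl mul1n.
have E2 : c.-1 * width d + width d = c * width d by rewrite E1 subnK.
have E3 : c.+1 * width d = c * width d + width d by rewrite mulSn addnC.
have E4 : c.+1 * width d + width d = c * width d + 2 * width d by rewrite E3; lia.
rewrite /load E2 E4 E1 E3; move: le_w {E1 E2 E3 E4}.
move: (c * width d) => a; move: (width d) => w le_wa.
have : gapsum (reach a w) (G h) + 2 * gapsum (room_in (a - w) a) (G h) +
    gapsum (room_in a (a + w)) (G h) +
    2 * gapsum (room_in (a + w) (a + 2 * w)) (G h) <=
    gapsum (ends_in (a - w) (a + 2 * w)) (G h).
  rewrite -!gapsumM -!gapsumD; apply: leq_gapsum => g; exact: reach_ends.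
have -> : gapsum (span_in (a - w) (a + 2 * w)) (G h) =
    gapsum (span_in (a - w) a) (G h) + gapsum (span_in a (a + w)) (G h) +
    gapsum (span_in (a + w) (a + 2 * w)) (G h).
  rewrite -!gapsumD; apply: eq_bigr => g _.
  have le1 : a - w <= a by lia.
  have le2 : a <= a + w by lia.
  have le3 : a + w <= a + 2 * w by lia.
  by rewrite (span_in_cat _ (leq_trans le1 le2) le3) (span_in_cat _ le1 le2).
by nia.
Qed.

Lemma playableS d : d < D -> playable d -> playable d.+1.
Proof.
move=> lt_dD IH h j le_n leQ.
have w_gt0 := width_gt0 d; have N_gt0 := quota_gt0 d.
have EN := quotaS d.
have m_gt0 : 200 <= margin by rewrite /margin; nia.
have r_gt0 : 200 <= ratio by rewrite /ratio; nia.
have b_big : 200 * margin <= branch by rewrite /branch leq_mul2r r_gt0 orbT.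
have N'_ge : 7 * quota d <= quota d.+1 by rewrite EN leq_mul2r; lia.
set N := INR (quota d).
have N1 : (1 <= N)%R by exact: (natr_le N_gt0).
have ENR : INR (quota d.+1) = (INR branch * N)%R by rewrite EN natrM.
have b1 : (1 <= INR branch)%R by apply: (@natr_le 1); lia.
set y := (INR (load d.+1 j h) / INR (quota d.+1))%R.
have y0 : (0 <= y)%R.
  by apply: Rmult_le_pos; [exact: pos_INR|left; apply: Rinv_0_lt_compat; nra].
rewrite /rate -/y.
(* If the required rate is not positive, a single real suffices, because the score never
   decreases. *)
case: (Rle_lt_dec (INR d.+1) (4 * y)) => [le_y|lt_y].
  exists [:: j * width d.+1 + margin * width d]; split.
  - by rewrite /= quota_gt0.
  - rewrite /deep /= andbT widthS.
    have : 2 * margin * width d <= branch * width d by rewrite leq_mul2r; lia.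
    by lia.
  rewrite /progress Rmult_1_l.
  have : score d.+1 h <= score d.+1 (h ++ [:: j * width d.+1 + margin * width d]).
    by apply: score_cat; rewrite size_cat /=; lia.
  move=> /natr_le; move: (INR (score _ _)) (INR (score _ (_ ++ _))) => u v le_uv.
  apply: (Rle_trans _ 0); first by lra.
  by apply: Rmult_le_pos; [have := pos_INR beta; lra|lra].
have yD : (4 * y <= INR D)%R by have := natr_le lt_dD; lra.
have lt_sb : 2 * margin + 2 < branch by lia.
(* As [y] is at most [D / 4], this exceeds the bound [6 * N * (y + 1 / 24)] on the cheapest
   window. *)
pose Z := 6 * quota d * D.+1.
have [k /andP[sk ks] cost] :=
  cheap_window (G h) (j * width d.+1) (width d) Z beta lt_sb.
rewrite -!widthS in cost; set X := gapsum _ _ in cost.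
have leX : (INR X <= 6 * N * (y + 1 / 24))%R.
  have D1 := natr_le D_gt0; have w1 := natr_le w_gt0.
  apply: (@window_arith (INR D) N (INR (width d)) (INR (load d.+1 j h))
     (INR (gapsum (span_in (j * width d.+1) (j * width d.+1 + width d.+1)) (G h)))
     _ (INR margin) (INR branch)) => //.
  - by rewrite /margin !natrM; congr (_ * _ * _)%R; rewrite INR_IZR_INZ.
  - by rewrite /branch /ratio !natrM; congr (_ * _ * _)%R; rewrite INR_IZR_INZ.
  - by rewrite -ENR /y; field; rewrite ENR; nra.
  - have : beta * gapsum (span_in (j * width d.+1) (j * width d.+1 + width d.+1)) (G h)
      <= load d.+1 j h by apply: leq_addl.
    move=> /natr_le; rewrite natrM.
    have -> : INR (load d.+1 j h) = (y * (INR branch * N))%R.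
      by rewrite -ENR /y; field; rewrite ENR; nra.
    have -> : N = (INR beta * INR (width d))%R by exact: natrM.
    move=> H.
    by apply: (Rmult_le_reg_l (INR beta)); [exact: (natr_lt beta_gt0)|lra].
  have := natr_cost cost.
  suff -> : INR (branch - 2 * margin - 2) = (INR branch - 2 * INR margin - 2)%R.
    by rewrite -/(load d.+1 j h).
  have sub r b s : r + (s + s + 2) = b -> INR r = (INR b - 2 * INR s - 2)%R.
    by move=> <-; rewrite !natrD /=; lra.
  by apply: sub; lia.
have ltXZ : X < Z.
  have EZ q : INR (6 * q * D.+1) = (6 * INR q * (INR D + 1))%R.
    by rewrite natrM S_INR natrM (_ : INR 6 = 6%R) // INR_IZR_INZ.
  apply/ltP/INR_lt; rewrite EZ -/N; have D1 := natr_le D_gt0.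
  by apply: Rle_lt_trans leX _; rewrite /= in D1; nra.
(* The middle tile of the window, numbered among all tiles of level [d]. *)
pose c := j * branch + k + 1.
have c_gt0 : 0 < c by rewrite /c addn1.
have Ec : c * width d = j * width d.+1 + k * width d + width d.
  by rewrite /c widthS; nia.
have := window_cost_ends ltXZ; rewrite -/X.
have -> : j * width d.+1 + k * width d = c * width d - width d by lia.
have -> : c * width d - width d + 3 * width d = c * width d + 2 * width d by lia.
move=> /(window_loads c_gt0) /natr_le leX'.
have leW u : u < j * branch + branch - margin -> u * width d + width d <= Q.
  move=> lt_u; apply: leq_trans leQ; rewrite addnC -mulSn widthS mulnA -mulnDl.
  by rewrite leq_mul2r; lia.
(* A load ratio lower by 1/4 raises the rate by 1, which makes up for the level lost. *)
have light u : j * branch + margin <= u -> u < j * branch + branch - margin ->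
    (INR (load d u h) <= N * (y - 1 / 4))%R ->
    exists t, [/\ 0 < size t <= quota d.+1, deep d.+1 j t &
      (INR (size t) * (INR d.+1 - 4 * y) <= progress d.+1 h (h ++ t))%R].
  move=> le_u lt_u light_u; have [|t [/andP[t0 tN] dt pt]] := IH h u _ (leW u lt_u).
    by lia.
  exists t; split; [by rewrite t0; lia|by apply: playableS_deep dt; lia|].
  apply: Rle_trans (Rle_trans _ _ _ _ pt) _.
    apply: Rmult_le_compat_l; first exact: pos_INR.
    rewrite /rate S_INR -/N.
    have : (INR (load d u h) / N <= y - 1 / 4)%R.
      by apply: (Rmult_le_reg_r N); [lra|field_simplify; lra].
    by lra.
  have := gain_cat d (h := h) (t := t); rewrite size_cat => /(_ ltac:(lia)) /natr_le.
  rewrite /progress !scoreS.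
  rewrite [INR (score d (h ++ t) + _)]natrD [INR (score d h + _)]natrD.
  by have b0 := pos_INR beta; nra.
case: (Rle_lt_dec (INR (load d c.-1 h)) (N * (y - 1 / 4))) => [|heavy1].
  by apply: light; rewrite /c; lia.
case: (Rle_lt_dec (INR (load d c h)) (N * (y - 1 / 4))) => [|heavy2].
  by apply: light; rewrite /c; lia.
case: (Rle_lt_dec (INR (load d c.+1 h)) (N * (y - 1 / 4))) => [|heavy3].
  by apply: light; rewrite /c; lia.
(* All three children are heavy, so in units of [N] at most [6 y + 1/4 - 5 (y - 1/4) = y + 3/2]
   remains for [reach] and its variation term. *)
have [|||t [/andP[t0 tN] dt pt]] := @play_center d h c y IH c_gt0.
- by lia.
- by apply: leW; rewrite /c; lia.
- move: leX'; move: (_ + _) (load d c.-1 h) (load d c h) (load d c.+1 h) heavy1 heavy2 heavy3.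
  move=> r l1 l2 l3; rewrite !natrD -/N; lra.
exists t; split; [by rewrite t0; lia| |exact: pt].
by apply: playableS_deep dt; rewrite /c; lia.
Qed.

Lemma playable0 : playable 0.
Proof.
move=> h k le_n leQ; exists [:: k]; split.
- by rewrite /= quota_gt0.
- by rewrite /deep /= /width expn0; lia.
rewrite /progress /score !big_ord0 /= Rmult_1_l /Rminus Rplus_opp_r Rmult_0_r.
rewrite /rate /= /Rdiv; have := pos_INR (load 0 k h).
have /Rinv_0_lt_compat := natr_lt (quota_gt0 0).
by move: (INR _) (Rinv _) => u v /=; nra.
Qed.

Lemma playable_le d : d <= D -> playable d.
Proof.
by elim: d => [|d IH] ?; [exact: playable0|apply: playableS => //; apply/IH/ltnW].
Qed.

(** * Bounding the score and playing the root *)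

Lemma gapsum_room_le h : size h <= n -> gapsum room (G h) <= M.
Proof.
elim/last_ind: h => [|h x IH]; first by rewrite G0 /gapsum big_seq1.
rewrite size_rcons => lt_n; have := gapsum_room_lt (GS x lt_n).
by have := IH (ltnW lt_n); lia.
Qed.

Lemma sum_width_le d : \sum_(i < d.+1) width i <= 2 * width d.
Proof.
elim: d => [|d IH]; first by rewrite big_ord1 leq_pmull.
rewrite big_ord_recr /= (leq_trans (leq_add IH (leqnn _))) // widthS.
by have := branch_gt1; nia.
Qed.

(** Widths grow geometrically, so all levels together count at most twice the largest counted width,
    which is at most [ratio] times its depth; a jump there raises the variation by twice that
    depth. *)
Lemma sum_jump_le d S S' : gapsum span S <= gapsum span S' ->
  \sum_(i < d) jump i S S' + ratio * gapsum span S <= ratio * gapsum span S'.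
Proof.
move=> le_S; elim: d => [|d IH]; first by rewrite big_ord0 leq_mul2l le_S orbT.
rewrite big_ord_recr /= {2}/jump; case: ifP => [jd|_]; last by rewrite addn0.
apply: leq_trans (leq_mul (leqnn ratio) jd).
rewrite mulnDr addnC leq_add2l mulnCA.
apply: leq_trans (leq_mul (leqnn 2) (width_depth d)).
apply: leq_trans (sum_width_le d); rewrite big_ord_recr /= leq_add2r.
by apply: leq_sum => i _; rewrite /jump; case: ifP.
Qed.

Lemma sum_jumps_le h : size h <= n ->
  \sum_(i < D) jumps i h <= ratio * gapsum span (G h).
Proof.
elim/last_ind: h => [|h x IH]; first by rewrite /jumps big1 // => i _; rewrite big_ord0.
rewrite size_rcons => lt_n.
under eq_bigr do rewrite jumps_rcons.
rewrite big_split /=; have := IH (ltnW lt_n).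
have := sum_jump_le D (gapsum_span_mono (GS x lt_n)).
by move: (\sum_(i < D) _) (\sum_(i < D) _); lia.
Qed.

Lemma score_le h : size h <= n -> score D h <= (3 * D + ratio) * B.
Proof.
move=> le_n; rewrite /score /gain big_split /= mulnDl.
apply: leq_add; last first.
  by apply: leq_trans (sum_jumps_le le_n) _; rewrite leq_mul2l GB ?orbT.
rewrite (leq_trans (n := \sum_(i < D) 3 * B)) //.
  apply: leq_sum => i _.
  have : gapsum (span_upto (width i)) (G h) <= gapsum span (G h).
    by apply: leq_gapsum => g; rewrite geq_minl.
  by have := GB le_n; lia.
by rewrite sum_nat_const card_ord; lia.
Qed.

(** The load of the root stays below an eighth of [D] quotas, so the rate is at least [D / 2] for at
    least [n / 2] reals. As the score is at most [203 * D * B], the constant is 4 * 80 * 203. *)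
Theorem game_bound : 8 * (M + beta * B) <= D * quota D -> 2 * quota D <= n ->
  (INR n <= 64960 * (INR beta * INR B))%R.
Proof.
move=> le_load le_n; set N := quota D in le_load le_n.
have N_gt0 : 0 < N by exact: quota_gt0.
have NR : (0 < INR N)%R by exact: (natr_lt N_gt0).
have D1 : (1 <= INR D)%R by exact: (natr_le D_gt0).
have rate_ge h : size h <= n -> (INR D / 2 <= rate D 0 h)%R.
  move=> szh; have : load D 0 h <= M + beta * B.
    apply: leq_add; last rewrite leq_mul2l; [|apply/orP; right].
      apply: leq_trans (gapsum_room_le szh); apply: leq_gapsum => g.
      by rewrite /room_in; case: ifP.
    by apply: leq_trans (GB szh); apply: leq_gapsum => g; apply: span_in_le.
  rewrite /rate -/N => leL.
  have N8 a b c : 8 * a <= b * c -> (8 * INR a <= INR b * INR c)%R.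
    by move=> /natr_le; rewrite !natrM (_ : INR 8 = 8%R) // INR_IZR_INZ.
  have H : (8 * INR (load D 0 h) <= INR D * INR N)%R by apply: N8; lia.
  suff : (INR (load D 0 h) / INR N <= INR D / 8)%R by lra.
  by apply: (Rmult_le_reg_r (INR N)); [lra|field_simplify; lra].
have loop m : exists h, [/\ size h <= n, m <= size h \/ n < size h + N &
    (INR (size h) * (INR D / 2) <= progress D [::] h)%R].
  elim: m => [|m [h [szh [le_m|lt_n] ph]]].
  - by exists [::]; split => //; [left|rewrite /progress /=; lra].
  - have [le_hN|lt_n] := leqP (size h + N) n; last by exists h; split=> //; right.
    have [|t [/andP[t0 tN] _ pt]] := playable_le (leqnn D) le_hN (k := 0).
      by rewrite mul0n add0n.
    exists (h ++ t); split; rewrite size_cat; [lia|by left; lia|].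
    rewrite natrD; move: ph pt; rewrite /progress => ph pt.
    have := Rmult_le_compat_l _ _ _ (pos_INR (size t)) (rate_ge h szh).
    by lra.
  - by exists h; split=> //; right.
have [h [szh H ph]] := loop n.
have le_n2 : n <= size h + size h by case: H; lia.
have := natr_le (score_le szh); have := natr_le le_n2.
rewrite natrD natrM => n2 sc.
have b0 := pos_INR beta; have B0 := pos_INR B; have s0 := pos_INR (score D [::]).
have : (INR (3 * D + ratio) = 203 * INR D)%R.
  have -> : 3 * D + ratio = 203 * D by rewrite /ratio; lia.
  by rewrite natrM INR_IZR_INZ.
move=> E; rewrite E in sc.
have : (80 * INR beta * (INR (score D h) - INR (score D [::])) <=
    80 * INR beta * (203 * INR D * INR B))%R.
  by apply: Rmult_le_compat_l; lra.
move: ph; rewrite /progress => ph le_sc.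
by apply: (Rmult_le_reg_l (INR D)); nra.
Qed.

End Game.

(** * Gaps of a run *)

Lemma positions_rcons alg s a :
  positions alg (rcons s a) = rcons (positions alg s) (alg s a).
Proof.
rewrite /positions size_rcons mkseqS; congr rcons; last first.
  by rewrite nth_rcons ltnn eqxx -cats1 take_size_cat.
apply/eq_in_map => i; rewrite mem_iota add0n => /andP[_ lt_i].
by rewrite nth_rcons lt_i -cats1 takel_cat // ltnW.
Qed.

Lemma size_positions alg s : size (positions alg s) = size s.
Proof. exact: size_mkseq. Qed.

Lemma positions_cat alg s t :
  exists u, positions alg (s ++ t) = positions alg s ++ u.
Proof.
elim/last_ind: t => [|t a [u E]]; first by exists [::]; rewrite !cats0.
exists (rcons u (alg (s ++ t) a)).
by rewrite -rcons_cat positions_rcons E rcons_cat.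
Qed.

Lemma valid_run_cat m alg s t : valid_run m alg (s ++ t) -> valid_run m alg s.
Proof.
rewrite /valid_run; have [u ->] := positions_cat alg s t.
by rewrite all_cat cat_uniq => -[/andP[-> _] /and3P[-> _ _]].
Qed.

(** A scan of the array: [p] is the last real met, at first the sentinel 0, and [k] counts the empty
    cells since. *)
Fixpoint gaps_from Q p k (c : seq (option nat)) : seq gap :=
  match c with
  | [::] => [:: (p, k, Q)]
  | None :: c' => gaps_from Q p k.+1 c'
  | Some v :: c' => (p, k, v) :: gaps_from Q v 0 c'
  end.

Lemma gaps_from_head Q c : exists r q S, forall p k,
  gaps_from Q p k c = (p, k + r, q) :: S.
Proof.
elim: c => [|[v|] c [r [q [S E]]]].
- by exists 0, Q, [::] => p k; rewrite addn0.
- by exists 0, v, (gaps_from Q v 0 c) => p k; rewrite addn0.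
- by exists r.+1, q, S => p k; rewrite /= E addSnnS.
Qed.

Lemma insertion_cons x g S S' :
  insertion x S S' -> insertion x (g :: S) (g :: S').
Proof. by case=> S1 p m1 m2 q S2; exact: (Insertion x (g :: S1)). Qed.

Lemma insertion_gaps_from Q x c1 c2 p k :
  insertion x (gaps_from Q p k (c1 ++ None :: c2))
              (gaps_from Q p k (c1 ++ Some x :: c2)).
Proof.
elim: c1 p k => [|[v|] c1 IH] p k /=; last exact: IH.
  have [r [q [S E]]] := gaps_from_head Q c2.
  by rewrite !E addSn add0n; exact: (Insertion x [::]).
exact: insertion_cons.
Qed.

Lemma gaps_from_nseq Q p k m :
  gaps_from Q p k (nseq m None) = [:: (p, k + m, Q)].
Proof. by elim: m k => [|m IH] k /=; rewrite ?addn0 // IH addSnnS. Qed.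

(** * A competitive algorithm as a player of the game *)

Section Reduction.

Context (alg : online_alg) (gamma Delta : R) (n Q : nat).
Context (Q_gt0 : 0 < Q).
Context (comp : competitive gamma Delta n alg).

Let m := num_cells gamma n.
Definition level (v : nat) : R := (INR v / INR Q)%R.
Definition stream (h : seq nat) := [seq level (minn v Q) | v <- h].
Definition cell h j : option nat :=
  let pos := positions alg (stream h) in
  if j \in pos then Some (minn (nth 0 h (index j pos)) Q) else None.
Definition cells h := [seq cell h j | j <- iota 0 m].
Definition state h := gaps_from Q 0 0 (cells h).

Lemma INRQ_gt0 : (0 < INR Q)%R.
Proof. exact: (natr_lt Q_gt0). Qed.

Lemma level_bounds v : v <= Q -> (0 <= level v <= 1)%R.
Proof.
move=> /natr_le le_v; have Q0 := INRQ_gt0; have v0 := pos_INR v.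
split; first by apply: Rmult_le_pos => //; left; exact: Rinv_0_lt_compat.
by apply: (Rmult_le_reg_r (INR Q)) => //; rewrite /level; field_simplify; lra.
Qed.

Lemma competitive_stream h : size h = n -> valid_run m alg (stream h) /\
  (sort_cost (final_order m alg (stream h)) <= Delta)%R.
Proof.
move=> sz_h; apply: comp; first by rewrite size_map.
move=> i; rewrite size_map => lt_i; rewrite (nth_map 0) //.
exact: level_bounds (geq_minr _ _).
Qed.

(** Competitiveness speaks of streams of length [n] only, so the history is padded with zeros. *)
Lemma valid_stream h : size h <= n -> valid_run m alg (stream h).
Proof.
move=> le_n; apply: (@valid_run_cat _ _ _ (stream (nseq (n - size h) 0))).
rewrite -map_cat; apply: (proj1 (competitive_stream _)).
by rewrite size_cat size_nseq subnKC.
Qed.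

Lemma state_nil : state [::] = [:: (0, m, Q)].
Proof.
have -> : state [::] = gaps_from Q 0 0 (nseq m None); last first.
  by rewrite gaps_from_nseq.
rewrite /state; congr gaps_from; apply: (@eq_from_nth _ None).
  by rewrite size_map size_iota size_nseq.
rewrite size_map size_iota => j lt_j.
by rewrite nth_nseq lt_j (nth_map 0) ?size_iota.
Qed.

Lemma state_insertion h x : size h < n ->
  insertion (minn x Q) (state h) (state (rcons h x)).
Proof.
move=> lt_n; have := valid_stream (h := rcons h x).
rewrite size_rcons => /(_ lt_n); rewrite /valid_run.
have Epos : positions alg (stream (rcons h x)) =
    rcons (positions alg (stream h)) (alg (stream h) (level (minn x Q))).
  by rewrite /stream map_rcons positions_rcons.
set j0 := alg _ _ in Epos; rewrite Epos all_rcons rcons_uniq.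
move=> [/andP[lt_j0 _] /andP[j0_new _]].
have sz_pos : size (positions alg (stream h)) = size h.
  by rewrite size_positions size_map.
have cell_old j : j != j0 -> cell (rcons h x) j = cell h j.
  move=> ne_j; rewrite /cell Epos mem_rcons inE (negPf ne_j) /=.
  case: ifP => // j_pos.
  rewrite -[rcons (positions _ _) _]cats1 index_cat j_pos nth_rcons.
  by rewrite -sz_pos index_mem j_pos.
have cell_new : cell (rcons h x) j0 = Some (minn x Q).
  rewrite /cell Epos mem_rcons inE eqxx /=.
  rewrite -[rcons (positions _ _) _]cats1 index_cat (negPf j0_new) /=.
  by rewrite eqxx addn0 sz_pos nth_rcons ltnn eqxx.
have cell_none : cell h j0 = None by rewrite /cell (negPf j0_new).
have Eiota : iota 0 m = iota 0 j0 ++ j0 :: iota j0.+1 (m - j0.+1).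
  have {1}-> : m = j0 + (m - j0.+1).+1 by lia.
  by rewrite iotaD.
rewrite /state /cells Eiota !map_cat /= cell_new cell_none.
have -> : [seq cell (rcons h x) j | j <- iota 0 j0] = [seq cell h j | j <- iota 0 j0].
  by apply/eq_in_map => j; rewrite mem_iota => ?; apply: cell_old; lia.
have -> : [seq cell (rcons h x) j | j <- iota j0.+1 (m - j0.+1)] =
    [seq cell h j | j <- iota j0.+1 (m - j0.+1)].
  by apply/eq_in_map => j; rewrite mem_iota => ?; apply: cell_old; lia.
exact: insertion_gaps_from.
Qed.

Lemma final_order_cells h :
  final_order m alg (stream h) = [seq level v | v <- pmap id (cells h)].
Proof.
rewrite /final_order /cells; elim: (iota 0 m) => //= j js IH.
rewrite [cell h j]/cell; case: ifP => j_pos /=; rewrite IH //.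
congr cons; rewrite (nth_map 0) //.
by rewrite -(size_map (fun v => level (minn v Q))) -(size_positions alg) index_mem.
Qed.

Lemma level_dist a b : Rabs (level b - level a) = (INR (natdist a b) / INR Q)%R.
Proof.
have Q0 := INRQ_gt0.
have -> : (level b - level a = (INR b - INR a) * / INR Q)%R by rewrite /level; field; lra.
rewrite Rabs_mult (Rabs_pos_eq (/ _)); last by left; apply: Rinv_0_lt_compat.
congr (_ * _)%R; rewrite /natdist; case: (leqP a b) => [le_ab|/ltnW le_ba].
  have -> : a - b = 0 by apply/eqP.
  rewrite Rabs_pos_eq; last by have := natr_le le_ab; lra.
  by rewrite -{1}(subnK le_ab) natrD add0n; lra.
have -> : b - a = 0 by apply/eqP.
rewrite Rabs_minus_sym Rabs_pos_eq; last by have := natr_le le_ba; lra.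
by rewrite -{1}(subnK le_ba) natrD addn0; lra.
Qed.

Lemma cost_gaps_from c p k :
  foldr Rplus 0%R (pairmap (fun x y => Rabs (y - x)) (level p)
    (rcons [seq level v | v <- pmap id c] 1%R)) =
  (INR (gapsum span (gaps_from Q p k c)) / INR Q)%R.
Proof.
have Q0 := INRQ_gt0.
have cons_span g S : (INR (gapsum span (g :: S)) / INR Q =
    Rabs (level (rval g) - level (lval g)) + INR (gapsum span S) / INR Q)%R.
  by rewrite level_dist -/(span g) /gapsum big_cons natrD; field; lra.
elim: c p k => [|[v|] c IH] p k /=; last exact: IH.
  rewrite cons_span /gapsum big_nil /= /rval /lval /=.
  have -> : level Q = 1%R by rewrite /level; field; lra.
  by field; lra.
by rewrite cons_span (IH v 0).
Qed.

(** Variation only grows, so the final cost of a padded history bounds it at every time. *)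
Lemma span_state h : size h <= n -> (INR (gapsum span (state h)) <= Delta * INR Q)%R.
Proof.
move=> le_n; have Q0 := INRQ_gt0.
have sz : size (h ++ nseq (n - size h) 0) = n by rewrite size_cat size_nseq subnKC.
have le_sz : size (h ++ nseq (n - size h) 0) <= n by rewrite sz.
have := natr_le (gapsum_span_cat state_insertion le_sz).
have [_] := competitive_stream sz.
rewrite final_order_cells /sort_cost.
have level0 : level 0 = 0%R by rewrite /level /=; field; lra.
have := cost_gaps_from (cells (h ++ nseq (n - size h) 0)) 0 0.
rewrite level0 -/(state _) => ->.
move: (INR _) => x le_x le_hx; apply: Rle_trans le_hx _.
have -> : x = (x / INR Q * INR Q)%R by field; lra.
by apply: Rmult_le_compat_r; lra.
Qed.

End Reduction.

(** * Choice of the parameters *)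

Definition nfloor (x : R) := Z.to_nat (Int_part x).

Lemma nfloor_spec x : (0 <= x)%R -> (INR (nfloor x) <= x < INR (nfloor x) + 1)%R.
Proof.
move=> x0; have [le_x lt_x] := base_Int_part x.
have ge0 : (0 <= Int_part x)%Z by apply/Z.lt_succ_r/lt_IZR; rewrite succ_IZR; lra.
by rewrite /nfloor INR_IZR_INZ Z2Nat.id //; lra.
Qed.

(** With [beta] the floor of [n / (100000 * Q * Delta)] and [B] that of [Delta * Q], [beta * B] is
    at most [n / 100000]. For larger [D] the load condition of [game_bound] would hold and give
    [n <= 0.6496 n]. *)
Lemma competitive_levels alg gamma Delta n D : 0 < D ->
  (1 <= gamma)%R -> (1 <= Delta)%R -> competitive gamma Delta n alg ->
  (INR (width D D) * Delta <= INR n / 100000)%R ->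
  (INR D / 100000 <= 32 * (gamma * Delta))%R.
Proof.
move=> D_gt0 g1 d1 comp; set Q := width D D => small.
have Q_gt0 : 0 < Q by exact: (width_gt0 D_gt0 D).
have Q1 : (1 <= INR Q)%R by exact: (natr_le Q_gt0).
have QD1 : (1 <= INR Q * Delta)%R by nra.
have n0 : (100000 <= INR n)%R by lra.
set x := (INR n / 100000 / (INR Q * Delta))%R.
have x1 : (1 <= x)%R.
  by apply: (Rmult_le_reg_r (INR Q * Delta)); [lra|rewrite /x; field_simplify; lra].
have [bx xb] := nfloor_spec (Rle_trans _ _ _ Rle_0_1 x1).
set beta := nfloor x in bx xb.
have beta_gt0 : 0 < beta by apply/ltP/INR_lt => /=; lra.
have b1 : (1 <= INR beta)%R by exact: (natr_le beta_gt0).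
have [BD _] : (INR (nfloor (Delta * INR Q)) <= Delta * INR Q < INR (nfloor (Delta * INR Q)) + 1)%R.
  by apply: nfloor_spec; nra.
set B := nfloor _ in BD.
have [Mg _] : (INR (num_cells gamma n) <= gamma * INR n < INR (num_cells gamma n) + 1)%R.
  by apply: nfloor_spec; nra.
set M := num_cells gamma n in Mg.
have Ex : (x * (INR Q * Delta) = INR n / 100000)%R by rewrite /x; field; lra.
have bQD : (INR beta * (INR Q * Delta) <= INR n / 100000)%R by nra.
have bQD' : (INR n / 200000 <= INR beta * (INR Q * Delta))%R by nra.
have bB : (INR beta * INR B <= INR n / 100000)%R by nra.
have GB h : size h <= n -> gapsum span (state alg gamma n Q h) <= B.
  move=> szh; have := span_state Q_gt0 comp szh; move: (gapsum _ _) => v le_v.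
  have [_] : (INR B <= Delta * INR Q < INR B + 1)%R by apply: nfloor_spec; nra.
  by rewrite -S_INR => lt_B; rewrite -ltnS; apply/ltP/INR_lt; lra.
apply: Rnot_lt_le => ltD.
have le_n : (INR n <= 64960 * (INR beta * INR B))%R; last by lra.
apply: (game_bound D_gt0 beta_gt0 (G := state alg gamma n Q) (M := M)) => //.
- exact: state_nil.
- exact: (state_insertion Q_gt0 comp).
- apply/leP/INR_le; rewrite /quota -/Q.
  have -> : INR (8 * (M + beta * B)) = (8 * (INR M + INR beta * INR B))%R.
    by rewrite natrM natrD natrM (_ : INR 8 = 8%R) // INR_IZR_INZ.
  rewrite !natrM.
  apply: (Rmult_le_reg_r Delta); first lra.
  have : (INR D * (INR n / 200000) <= INR D * (INR beta * (INR Q * Delta)))%R.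
    by apply: Rmult_le_compat_l => //; exact: pos_INR.
  have : (INR n * (32 * (gamma * Delta)) <= INR n * (INR D / 100000))%R.
    by apply: Rmult_le_compat_l; lra.
  have : (INR M * Delta <= gamma * INR n * Delta)%R.
    by apply: Rmult_le_compat_r; lra.
  have : (INR beta * INR B * Delta <= gamma * INR n * Delta)%R.
    by apply: Rmult_le_compat_r; [lra|nra].
  by lra.
- apply/leP/INR_le; rewrite /quota -/Q.
  have -> : INR (2 * (beta * Q)) = (2 * (INR beta * INR Q))%R by rewrite !natrM.
  by nra.
Qed.

Lemma natrX m k : INR (m ^ k) = (INR m ^ k)%R.
Proof. by elim: k => // k IH; rewrite expnS natrM IH. Qed.

Lemma exp_natmul a k : (exp a ^ k = exp (INR k * a))%R.
Proof.
elim: k => [|k IH]; first by rewrite Rmult_0_l exp_0.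
by rewrite -tech_pow_Rmult IH -exp_plus S_INR; congr exp; ring.
Qed.

Lemma exp_ge_sqr a : (0 <= a)%R -> (a * a / 4 <= exp a)%R.
Proof.
move=> a0; have -> : (a = a / 2 + a / 2)%R by field.
by rewrite exp_plus; have := exp_ineq1_le (a / 2); nra.
Qed.

(** With [L = ln n] and [l = ln L], take [D] to be the floor of [L / (8 l)]. The branching number
    [40000 * D^3] is at most [exp (4 l)], so the root has width at most [exp (L / 2)], the square
    root of [n]. *)
Lemma exists_levels (n : nat) : 0 < n -> (0 < ln (INR n))%R ->
  (2000000 <= ln (ln (INR n)))%R -> exists D, [/\ 0 < D,
    (ln (INR n) / ln (ln (INR n)) <= 16 * INR D)%R &
    (INR (width D D) * ln (INR n) <= INR n / 100000)%R].
Proof.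
move=> n_gt0; set L := ln (INR n); set l := ln L => L_gt0 big_l.
have En : INR n = exp L by rewrite exp_ln //; exact: (natr_lt n_gt0).
have EL : L = exp l by rewrite exp_ln.
have le_lL : (8 * l <= L)%R.
  by rewrite EL; have := exp_ge_sqr (a := l); nra.
set x := (L / (8 * l))%R.
have Ex : (x * (8 * l) = L)%R by rewrite /x; field; lra.
have x1 : (1 <= x)%R by nra.
have [Dx xD] := nfloor_spec (Rle_trans _ _ _ Rle_0_1 x1).
set D := nfloor x in Dx xD.
have D_gt0 : 0 < D by apply/ltP/INR_lt => /=; lra.
have D1 : (1 <= INR D)%R by exact: (natr_le D_gt0).
exists D; split=> //.
  apply: (Rmult_le_reg_r l); first lra.
  by rewrite /Rdiv Rmult_assoc Rinv_l; nra.
have DL : (INR D <= exp l)%R by rewrite -EL; nra.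
have le_b : (INR (branch D) <= exp (INR 4 * l))%R.
  rewrite -exp_natmul; have Eb : INR (branch D) = (40000 * (INR D * (INR D * INR D)))%R.
    by rewrite /branch /ratio /margin !natrM (_ : INR 200 = 200%R); [ring|rewrite INR_IZR_INZ].
  have l40 : (40000 <= exp l)%R by have := exp_ineq1_le l; lra.
  rewrite Eb /= Rmult_1_r.
  apply: Rmult_le_compat; [lra|nra|lra|].
  apply: Rmult_le_compat; [lra|nra|lra|].
  by apply: Rmult_le_compat; lra.
have leQ : (INR (width D D) <= exp (L / 2))%R.
  rewrite /width natrX; apply: Rle_trans (pow_incr _ _ D _) _.
    by split; [exact: pos_INR|exact: le_b].
  rewrite exp_natmul; have -> : INR 4 = 4%R by rewrite INR_IZR_INZ.
  have : (INR D * (4 * l) <= L / 2)%R by nra.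
  by case=> [/exp_increasing ?|->]; lra.
have leL : (100000 * L <= exp (L / 2))%R.
  by have := exp_ge_sqr (a := (L / 2)%R); nra.
rewrite En; have -> : exp L = (exp (L / 2) * exp (L / 2))%R.
  by rewrite -exp_plus; congr exp; field.
have := exp_pos (L / 2); have := pos_INR (width D D).
by nra.
Qed.

Local Open Scope R_scope.

Theorem theorem1 :
  exists c : R, 0 < c /\
  exists n0 : nat, forall n : nat, (n0 <= n)%N ->
    forall gamma Delta : R, 1 <= gamma -> 1 <= Delta ->
      (exists alg : online_alg, competitive gamma Delta n alg) ->
      c * (ln (INR n) / ln (ln (INR n))) <= gamma * Delta.
Proof.
(* The denominator is 32 * 100000 from [competitive_levels] times 16 from [exists_levels]. *)
exists (1 / 51200000); split; first lra.
set K := exp (exp 2000000).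
exists (nfloor K).+1 => n le_n gamma Delta g1 d1 [alg comp].
have ltK : K < INR n.
  have [_ lt_K] := nfloor_spec (Rlt_le _ _ (exp_pos (exp 2000000))).
  by apply: Rlt_le_trans lt_K _; rewrite -S_INR; exact: natr_le.
have lt_L : exp 2000000 < ln (INR n).
  by rewrite -[exp 2000000]ln_exp; apply: ln_increasing => //; exact: exp_pos.
have lt_l : 2000000 < ln (ln (INR n)).
  by rewrite -{1}[2000000]ln_exp; apply: ln_increasing => //; exact: exp_pos.
have L_gt0 := Rlt_trans _ _ _ (exp_pos _) lt_L.
(* If [Delta] exceeds [ln n] the bound is immediate; otherwise [ln n] may replace [Delta] in the
   size condition on the root. *)
have [le_d|lt_d] := Rle_lt_dec Delta (ln (INR n)); last first.
  have : ln (INR n) / ln (ln (INR n)) <= ln (INR n).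
    apply: (Rmult_le_reg_r (ln (ln (INR n)))); first lra.
    by rewrite /Rdiv Rmult_assoc Rinv_l; nra.
  by nra.
have [|//||D [D_gt0 leD small]] := @exists_levels n; [exact: leq_trans le_n|lra|].
have := competitive_levels D_gt0 g1 d1 comp.
have := pos_INR (width D D).
by move=> w0 /(_ _) H; have : INR (width D D) * Delta <= INR n / 100000 by [nra]; move/H; lra.
Qed.
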